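(* Let $(\mathcal{S},\wedge,S)$ be an internally tensored and cotensored (closed) triangulated symmetric monoidal category with unit $S$, and let $R$ be a ring (monoid object) in $\mathcal{S}$ with product $\mu: R\wedge R\to R$ and unit $i: S\to R$. Let $\mathbf{I}$ be any Ideal of $R$, with $\mathbf{I}(b,a)=I$, structure maps $\mu_L: R\wedge I\to I$, $\mu_R: I\wedge R\to I$, $\nu_L: R\wedge I\to R$, $\nu_R: I\wedge R\to R$, and associated maps $j_L,j_R: I\to R$ (all as defined in the context). Then the following hold. \begin{enumerate} \item $\mu_R$ and $\mu_L$ make $I$ a unital $R$-$R$-bimodule. \item $\nu_L$ and $\nu_R$ are $R$-$R$-bimodule homomorphisms. \item $j_L=j_R$. Write $j$ for this common value. \item $j$ is an $R$-$R$-bimodule map. \item $\mu_R(1\wedge j)=\mu_L(j\wedge 1)$ as maps $I\wedge I\to I$. \item $\nu_L=j\mu_L=\mu(1\wedge j)$ and $\nu_R=j\mu_R=\mu(j\wedge 1)$. \end{enumerate} Conversely, let $I$ be an $R$-$R$-bimodule in $\mathcal{S}$ with structure maps $\mu_L: R\wedge I\to I$ and $\mu_R: I\wedge R\to I$, and let $j: I\to R$ be an $R$-$R$-bimodule map satisfying $\mu_R(1\wedge j)=\mu_L(j\wedge 1)$. Then $\mu_L$ and $\mu_R$, together with the composites $\nu_L=j\mu_L$ and $\nu_R=j\mu_R$, make an Ideal of $R$ with morphism objects $R$ and $I$ (that is, $\mathbf{I}(a,a)=\mathbf{I}(a,b)=\mathbf{I}(b,b)=R$ and $\mathbf{I}(b,a)=I$)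 and compositions $\mu$, $\mu_L$, $\mu_R$, $\nu_L$ and $\nu_R$.
   Context: Notation: $\wedge$ is the symmetric monoidal product of $\mathcal{S}$ and $S$ its unit; associativity and unit isomorphisms of $\wedge$ are suppressed where harmless, and $1$ denotes identity maps. A ring is a (unital, associative) monoid object $(R,\mu,i)$ in $\mathcal{S}$. $R$-$R$-bimodules are unital. Definition (Ideal). An Ideal of $R$ is a category $\mathbf{I}$ enriched over $\mathcal{S}$ with exactly two objects $a$ and $b$, with morphism objects $\mathbf{I}(a,a)=\mathbf{I}(a,b)=\mathbf{I}(b,b)=R$ and $\mathbf{I}(b,a)=I$ for some object $I$ of $\mathcal{S}$, in which the compositions $R\wedge R\to R$ are the product $\mu$ of $R$. Here $\mathbf{I}(x,y)$ is the object of morphisms from $x$ to $y$, and composition is a map $\mathbf{I}(y,z)\wedge\mathbf{I}(x,y)\to\mathbf{I}(x,z)$, written as the composite $z\leftarrow y\leftarrow x$. The identity maps of $a$ and $b$ are given by the unit $i: S\to R$. Of the eight compositions, the four with source $R\wedge R$ and target $R$ are $\mu$, namely $a\leftarrow a\leftarrow a$, $b\leftarrow a\leftarrow a$, $b\leftarrow b\leftarrow a$ and $b\leftarrow b\leftarrow b$. The other four are the structure maps - $(a\leftarrow a\leftarrow b)$: $\mu_L: R\wedge I\to I$, - $(a\leftarrow b\leftarrow b)$: $\mu_R: I\wedge R\to I$, - $(a\leftarrow b\leftarrow a)$: $\nu_R: I\wedge R\to R$, - $(b\leftarrow a\leftarrow b)$: $\nu_L: R\wedge I\to R$. These satisfy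 the unit and associativity axioms of an enriched category (16 associativity conditions, one for each sequence of four objects from $\{a,b\}$). The maps $j_L,j_R: I\to R$ are defined as the composites $$j_L: I\cong S\wedge I\xrightarrow{\,i\wedge 1\,}R\wedge I\xrightarrow{\,\nu_L\,}R,\qquad j_R: I\cong I\wedge S\xrightarrow{\,1\wedge i\,}I\wedge R\xrightarrow{\,\nu_R\,}R.$$ Bimodule structures: $R$ is an $R$-$R$-bimodule via $\mu$. $R\wedge I$ is an $R$-$R$-bimodule with left action $\mu\wedge 1: R\wedge R\wedge I\to R\wedge I$ and right action $1\wedge\mu_R: R\wedge I\wedge R\to R\wedge I$. $I\wedge R$ is an $R$-$R$-bimodule with left action $\mu_L\wedge 1: R\wedge I\wedge R\to I\wedge R$ and right action $1\wedge\mu: I\wedge R\wedge R\to I\wedge R$. *)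

(* Defs.v *)
From mathcomp Require Import all_boot.

Set Implicit Arguments.
Unset Strict Implicit.
Unset Printing Implicit Defensive.

Declare Scope cat_scope.
Delimit Scope cat_scope with cat.
Local Open Scope cat_scope.

Record category := Category {
  obj :> Type;
  hom : obj -> obj -> Type;
  idm : forall X, hom X X;
  ccomp : forall X Y Z, hom Y Z -> hom X Y -> hom X Z;
  ccomp1m : forall X Y (f : hom X Y), ccomp (idm Y) f = f;
  ccompm1 : forall X Y (f : hom X Y), ccomp f (idm X) = f;
  ccompA : forall W X Y Z (h : hom Y Z) (g : hom X Y) (f : hom W X),
    ccomp h (ccomp g f) = ccomp (ccomp h g) f }.

Arguments idm {c} X.

Notation "X ~> Y" := (hom X Y) (at level 90, Y at next level) : cat_scope.
Notation "g ∘ f" := (ccomp g f) (at level 40, left associativity) : cat_scope.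

Definition is_iso (C : category) (X Y : C) (f : X ~> Y) : Prop :=
  exists g : Y ~> X, g ∘ f = idm X /\ f ∘ g = idm Y.

Record monoidal_category := MonoidalCategory {
  mon_cat :> category;
  unitob : mon_cat;
  tens : mon_cat -> mon_cat -> mon_cat;
  tensm : forall X X' Y Y', (X ~> X') -> (Y ~> Y') -> (tens X Y ~> tens X' Y');
  tensm1 : forall X Y, tensm (idm X) (idm Y) = idm (tens X Y);
  tensm_comp : forall X X' X'' Y Y' Y'' (f : X ~> X') (f' : X' ~> X'')
      (g : Y ~> Y') (g' : Y' ~> Y''),
    tensm (f' ∘ f) (g' ∘ g) = tensm f' g' ∘ tensm f g;
  assoc : forall X Y Z, tens (tens X Y) Z ~> tens X (tens Y Z);
  assocV : forall X Y Z, tens X (tens Y Z) ~> tens (tens X Y) Z;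
  assocK : forall X Y Z, assocV X Y Z ∘ assoc X Y Z = idm _;
  assocVK : forall X Y Z, assoc X Y Z ∘ assocV X Y Z = idm _;
  assoc_nat : forall X X' Y Y' Z Z' (f : X ~> X') (g : Y ~> Y') (h : Z ~> Z'),
    assoc X' Y' Z' ∘ tensm (tensm f g) h = tensm f (tensm g h) ∘ assoc X Y Z;
  lunit : forall X, tens unitob X ~> X;
  lunitV : forall X, X ~> tens unitob X;
  lunitK : forall X, lunitV X ∘ lunit X = idm _;
  lunitVK : forall X, lunit X ∘ lunitV X = idm _;
  lunit_nat : forall X Y (f : X ~> Y),
    lunit Y ∘ tensm (idm unitob) f = f ∘ lunit X;
  runit : forall X, tens X unitob ~> X;
  runitV : forall X, X ~> tens X unitob;
  runitK : forall X, runitV X ∘ runit X = idm _;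
  runitVK : forall X, runit X ∘ runitV X = idm _;
  runit_nat : forall X Y (f : X ~> Y),
    runit Y ∘ tensm f (idm unitob) = f ∘ runit X;
  pentagon : forall W X Y Z,
    assoc W X (tens Y Z) ∘ assoc (tens W X) Y Z =
    tensm (idm W) (assoc X Y Z) ∘ assoc W (tens X Y) Z
      ∘ tensm (assoc W X Y) (idm Z);
  triangle : forall X Y,
    tensm (idm X) (lunit Y) ∘ assoc X unitob Y = tensm (runit X) (idm Y) }.

Arguments unitob {m}.

Notation "X ⊗ Y" := (tens X Y) (at level 38, left associativity) : cat_scope.
Notation "f ⊠ g" := (tensm f g) (at level 38, left associativity) : cat_scope.

Record symmetric_monoidal_category := SymmetricMonoidalCategory {
  sym_mon :> monoidal_category;
  sym : forall X Y : sym_mon, X ⊗ Y ~> Y ⊗ X;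
  sym_nat : forall (X X' Y Y' : sym_mon) (f : X ~> X') (g : Y ~> Y'),
    sym X' Y' ∘ (f ⊠ g) = (g ⊠ f) ∘ sym X Y;
  symK : forall X Y, sym Y X ∘ sym X Y = idm (X ⊗ Y);
  hexagon : forall X Y Z,
    assoc Y Z X ∘ sym X (Y ⊗ Z) ∘ assoc X Y Z =
    (idm Y ⊠ sym X Z) ∘ assoc Y X Z ∘ (sym X Y ⊠ idm Z) }.

Record closed_category := ClosedCategory {
  closed_sym :> symmetric_monoidal_category;
  ihom : closed_sym -> closed_sym -> closed_sym;
  ev : forall X Y, ihom X Y ⊗ X ~> Y;
  curry : forall X Y Z, (X ⊗ Y ~> Z) -> (X ~> ihom Y Z);
  curryK : forall X Y Z (f : X ⊗ Y ~> Z), ev Y Z ∘ (curry f ⊠ idm Y) = f;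
  curry_uniq : forall X Y Z (g : X ~> ihom Y Z),
    curry (ev Y Z ∘ (g ⊠ idm Y)) = g }.

Arguments ev {c} X Y.

Definition ihomr (C : closed_category) (W X Y : C) (f : X ~> Y) :
  ihom W X ~> ihom W Y := curry (f ∘ ev W X).

Definition ihoml (C : closed_category) (W X Y : C) (f : X ~> Y) :
  ihom Y W ~> ihom X W := curry (ev Y W ∘ (idm (ihom Y W) ⊠ f)).

(* The abelian group laws are spelled out because a zmodType would force a
   choice structure on the hom sets. *)
Record additive (C : category) := Additive {
  hadd : forall X Y : C, (X ~> Y) -> (X ~> Y) -> (X ~> Y);
  hzero : forall X Y : C, X ~> Y;
  hopp : forall X Y : C, (X ~> Y) -> (X ~> Y);
  haddA : forall X Y, associative (@hadd X Y);
  haddC : forall X Y, commutative (@hadd X Y);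
  hadd0 : forall X Y, left_id (hzero X Y) (@hadd X Y);
  haddN : forall X Y, left_inverse (hzero X Y) (@hopp X Y) (@hadd X Y);
  comp_haddl : forall X Y Z (g g' : Y ~> Z) (f : X ~> Y),
    hadd g g' ∘ f = hadd (g ∘ f) (g' ∘ f);
  comp_haddr : forall X Y Z (g : Y ~> Z) (f f' : X ~> Y),
    g ∘ hadd f f' = hadd (g ∘ f) (g ∘ f');
  zeroob : C;
  zeroobP : idm zeroob = hzero zeroob zeroob;
  biproducts : forall X Y : C,
    exists (Z : C) (i1 : X ~> Z) (i2 : Y ~> Z) (p1 : Z ~> X) (p2 : Z ~> Y),
      [/\ p1 ∘ i1 = idm X, p2 ∘ i2 = idm Y, p1 ∘ i2 = hzero Y X,
          p2 ∘ i1 = hzero X Y & hadd (i1 ∘ p1) (i2 ∘ p2) = idm Z] }.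

Record triangulation (C : category) := Triangulation {
  tri_add :> additive C;
  susp : C -> C;
  suspm : forall X Y : C, (X ~> Y) -> (susp X ~> susp Y);
  suspm1 : forall X, suspm (idm X) = idm (susp X);
  suspm_comp : forall X Y Z (g : Y ~> Z) (f : X ~> Y),
    suspm (g ∘ f) = suspm g ∘ suspm f;
  suspm_add : forall X Y (f g : X ~> Y),
    suspm (hadd tri_add f g) = hadd tri_add (suspm f) (suspm g);
  susp_full_faithful : forall X Y, bijective (@suspm X Y);
  susp_ess_surj : forall Y, exists X, exists f : susp X ~> Y, is_iso f;
  (* dist f g h: the triangle X -f-> Y -g-> Z -h-> susp X is distinguished *)
  dist : forall X Y Z : C, (X ~> Y) -> (Y ~> Z) -> (Z ~> susp X) -> Prop;
  dist_iso : forall X Y Z X' Y' Z' (f : X ~> Y) (g : Y ~> Z) (h : Z ~> susp X)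
      (f' : X' ~> Y') (g' : Y' ~> Z') (h' : Z' ~> susp X')
      (u : X ~> X') (v : Y ~> Y') (w : Z ~> Z'),
    is_iso u -> is_iso v -> is_iso w ->
    v ∘ f = f' ∘ u -> w ∘ g = g' ∘ v -> suspm u ∘ h = h' ∘ w ->
    dist f g h -> dist f' g' h';
  dist_id : forall X,
    dist (idm X) (hzero tri_add X (zeroob tri_add))
      (hzero tri_add (zeroob tri_add) (susp X));
  dist_cone : forall X Y (f : X ~> Y),
    exists (Z : C) (g : Y ~> Z) (h : Z ~> susp X), dist f g h;
  dist_rot : forall X Y Z (f : X ~> Y) (g : Y ~> Z) (h : Z ~> susp X),
    dist f g h <-> dist g h (hopp tri_add (suspm f));
  dist_fill : forall X Y Z X' Y' Z' (f : X ~> Y) (g : Y ~> Z) (h : Z ~> susp X)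
      (f' : X' ~> Y') (g' : Y' ~> Z') (h' : Z' ~> susp X')
      (u : X ~> X') (v : Y ~> Y'),
    dist f g h -> dist f' g' h' -> v ∘ f = f' ∘ u ->
    exists w : Z ~> Z', w ∘ g = g' ∘ v /\ suspm u ∘ h = h' ∘ w;
  dist_oct : forall X Y Z U V W (f : X ~> Y) (f' : Y ~> U) (f'' : U ~> susp X)
      (g : Y ~> Z) (g' : Z ~> W) (g'' : W ~> susp Y)
      (k' : Z ~> V) (k'' : V ~> susp X),
    dist f f' f'' -> dist g g' g'' -> dist (g ∘ f) k' k'' ->
    exists (u : U ~> V) (v : V ~> W),
      [/\ dist u v (suspm f' ∘ g''), u ∘ f' = k' ∘ g, k'' ∘ u = f'',
          v ∘ k' = g' & g'' ∘ v = suspm f ∘ k''] }.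

(* Compatibility between a closed symmetric monoidal structure and a
   triangulation, following Hovey, Palmieri and Strickland, Axiomatic stable
   homotopy theory, Definition A.2.1. *)
Record tri_compat (C : closed_category) (T : triangulation C) := TriCompat {
  stens : forall X Y : C, susp T X ⊗ Y ~> susp T (X ⊗ Y);
  stensV : forall X Y : C, susp T (X ⊗ Y) ~> susp T X ⊗ Y;
  stensK : forall X Y, stensV X Y ∘ stens X Y = idm _;
  stensVK : forall X Y, stens X Y ∘ stensV X Y = idm _;
  stens_nat : forall (X X' Y Y' : C) (f : X ~> X') (g : Y ~> Y'),
    stens X' Y' ∘ (suspm T f ⊠ g) = suspm T (f ⊠ g) ∘ stens X Y;
  stens_unit : forall X, suspm T (runit X) ∘ stens X unitob = runit (susp T X);
  stens_assoc : forall X Y Z,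
    suspm T (assoc X Y Z) ∘ stens (X ⊗ Y) Z ∘ (stens X Y ⊠ idm Z) =
    stens X (Y ⊗ Z) ∘ assoc (susp T X) Y Z;
  tens_exact : forall (X Y Z W : C) (f : X ~> Y) (g : Y ~> Z)
      (h : Z ~> susp T X),
    dist f g h ->
    dist (f ⊠ idm W) (g ⊠ idm W) (stens X W ∘ (h ⊠ idm W));
  (* The curried map is the comparison isomorphism
     susp (ihom W X) ~> ihom W (susp X). *)
  ihomr_exact : forall (X Y Z W : C) (f : X ~> Y) (g : Y ~> Z)
      (h : Z ~> susp T X),
    dist f g h ->
    exists2 d : ihom W Z ~> susp T (ihom W X),
      curry (suspm T (ev W X) ∘ stens (ihom W X) W) ∘ d = ihomr W h &
      dist (ihomr W f) (ihomr W g) d;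
  (* The curried map is the comparison isomorphism
     susp (ihom (susp X) W) ~> ihom X W; exactness in this contravariant
     variable is required up to a sign only. *)
  ihoml_exact : forall (X Y Z W : C) (f : X ~> Y) (g : Y ~> Z)
      (h : Z ~> susp T X),
    dist f g h ->
    exists2 d : ihom X W ~> susp T (ihom Z W),
      d ∘ curry (ev (susp T X) W ∘ sym (susp T X) (ihom (susp T X) W)
                   ∘ stensV X (ihom (susp T X) W)
                   ∘ suspm T (sym (ihom (susp T X) W) X)
                   ∘ stens (ihom (susp T X) W) X)
        = suspm T (ihoml W h) &
      dist (ihoml W g) (ihoml W f) d \/
      dist (ihoml W g) (ihoml W f) (hopp T d);
  sym_susp_unit :
    sym (susp T unitob) (susp T unitob) = hopp T (idm _) }.

Record closed_triangulated_category := ClosedTriangulatedCategory {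
  ct_closed :> closed_category;
  ct_tri : triangulation ct_closed;
  ct_compat : tri_compat ct_tri }.

Record ring_object (C : monoidal_category) := RingObject {
  ring_ob :> obj C;
  rmul : ring_ob ⊗ ring_ob ~> ring_ob;
  rone : unitob ~> ring_ob;
  rmulA : rmul ∘ (rmul ⊠ idm ring_ob) =
    rmul ∘ (idm ring_ob ⊠ rmul) ∘ assoc ring_ob ring_ob ring_ob;
  rmul1m : rmul ∘ (rone ⊠ idm ring_ob) = lunit ring_ob;
  rmulm1 : rmul ∘ (idm ring_ob ⊠ rone) = runit ring_ob }.

Record is_bimodule (C : monoidal_category) (R : ring_object C) (M : C)
    (l : R ⊗ M ~> M) (r : M ⊗ R ~> M) : Prop := IsBimodule {
  lact_unit : l ∘ (rone R ⊠ idm M) = lunit M;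
  lact_assoc : l ∘ (rmul R ⊠ idm M) = l ∘ (idm R ⊠ l) ∘ assoc R R M;
  ract_unit : r ∘ (idm M ⊠ rone R) = runit M;
  ract_assoc : r ∘ (r ⊠ idm R) = r ∘ (idm M ⊠ rmul R) ∘ assoc M R R;
  lract_assoc : r ∘ (l ⊠ idm R) = l ∘ (idm R ⊠ r) ∘ assoc R M R }.

Definition is_bimodule_map (C : monoidal_category) (R : ring_object C)
    (M N : C) (lM : R ⊗ M ~> M) (rM : M ⊗ R ~> M)
    (lN : R ⊗ N ~> N) (rN : N ⊗ R ~> N) (f : M ~> N) : Prop :=
  f ∘ lM = lN ∘ (idm R ⊠ f) /\ f ∘ rM = rN ∘ (f ⊠ idm R).

Section TensorActions.
Variables (C : monoidal_category) (R : ring_object C) (M : C).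

Definition RM_lact : R ⊗ (R ⊗ M) ~> R ⊗ M :=
  (rmul R ⊠ idm M) ∘ assocV R R M.
Definition RM_ract (r : M ⊗ R ~> M) : (R ⊗ M) ⊗ R ~> R ⊗ M :=
  (idm R ⊠ r) ∘ assoc R M R.
Definition MR_lact (l : R ⊗ M ~> M) : R ⊗ (M ⊗ R) ~> M ⊗ R :=
  (l ⊠ idm R) ∘ assocV R M R.
Definition MR_ract : (M ⊗ R) ⊗ R ~> M ⊗ R :=
  (idm M ⊠ rmul R) ∘ assoc M R R.

End TensorActions.

(* ecomp x y z is the composition z <- y <- x. *)
Record enriched (V : monoidal_category) (Ob : Type) (E : Ob -> Ob -> V) :=
  Enriched {
  ecomp : forall x y z, E y z ⊗ E x y ~> E x z;
  eid : forall x, unitob ~> E x x;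
  ecompA : forall w x y z,
    ecomp w x z ∘ (ecomp x y z ⊠ idm (E w x)) =
    ecomp w y z ∘ (idm (E y z) ⊠ ecomp w x y) ∘ assoc (E y z) (E x y) (E w x);
  ecomp1m : forall x y, ecomp x y y ∘ (eid y ⊠ idm (E x y)) = lunit (E x y);
  ecompm1 : forall x y, ecomp x x y ∘ (idm (E x y) ⊠ eid x) = runit (E x y) }.

Inductive ideal_ob := ob_a | ob_b.

Definition ideal_hom (C : monoidal_category) (R : ring_object C) (I : C)
    (x y : ideal_ob) : C :=
  match x, y with
  | ob_b, ob_a => I
  | _, _ => R
  end.

Record Ideal (C : monoidal_category) (R : ring_object C) (I : C) := MkIdeal {
  ideal_cat :> enriched (ideal_hom R I);
  ideal_aaa : ecomp ideal_cat ob_a ob_a ob_a = rmul R;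
  ideal_aab : ecomp ideal_cat ob_a ob_a ob_b = rmul R;
  ideal_abb : ecomp ideal_cat ob_a ob_b ob_b = rmul R;
  ideal_bbb : ecomp ideal_cat ob_b ob_b ob_b = rmul R;
  ideal_ida : eid ideal_cat ob_a = rone R;
  ideal_idb : eid ideal_cat ob_b = rone R }.

Section IdealMaps.
Variables (C : monoidal_category) (R : ring_object C) (I : C).
Variable (A : Ideal R I).

Definition ideal_muL : R ⊗ I ~> I := ecomp A ob_b ob_a ob_a.
Definition ideal_muR : I ⊗ R ~> I := ecomp A ob_b ob_b ob_a.
Definition ideal_nuL : R ⊗ I ~> R := ecomp A ob_b ob_a ob_b.
Definition ideal_nuR : I ⊗ R ~> R := ecomp A ob_a ob_b ob_a.
Definition ideal_jL : I ~> R := ideal_nuL ∘ (rone R ⊠ idm I) ∘ lunitV I.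
Definition ideal_jR : I ~> R := ideal_nuR ∘ (idm I ⊠ rone R) ∘ runitV I.

End IdealMaps.

(* Main.v *)
Require Import Defs.
From mathcomp Require Import all_boot.

Local Open Scope cat_scope.

(** From an Ideal to a bimodule. The morphism object from a to b is R, so the
    unit of R also names an arrow u : a -> b. It is not an identity, but since
    every composition between copies of R is the product, composing with u on
    either side just moves an element of R between the three morphism objects
    equal to R. For m : b -> a one has j_L m = u m and j_R m = m u, and the
    claims are instances of the associativity of strings of three arrows:
    - u m u, bracketed in both ways, gives j_L m = j_R m;
    - u r m and r u m give nu_L = j mu_L and nu_L = mu (1 ⊠ j), and
      symmetrically m r u and m u r compute nu_R; equating the two formulas
      for each of nu_L and nu_R shows that j is a bimodule map;
    - m u m' gives mu_R (1 ⊠ j) = mu_L (j ⊠ 1);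
    - strings without u give the associativity axioms of the bimodule and the
      linearity of nu_L and nu_R.
    Inserting u into a string means precomposing with a unit isomorphism; for
    u in the middle the triangle axiom removes it again, while u at an end is
    removed by Kelly's two further coherence laws for the unit ([lunit_assoc]
    and [assoc_runit]), which the pentagon and the triangle imply.

    From a bimodule to an Ideal. The maps [to_ring] from each morphism object
    to R, namely j on I and the identity elsewhere, turn all eight compositions
    into the product ([to_ring_comp]). Each associativity condition thus holds
    after [to_ring], which settles the twelve conditions whose target is R. Of
    the four with target I, three are bimodule axioms, and the last, for the
    objects b, a, b, a, is where mu_R (1 ⊠ j) = mu_L (j ⊠ 1) is used
    ([act_along_balanced]). *)

(** * Monoidal preliminaries *)

Lemma tensm_split_lr {C : monoidal_category} {X X' Y Y' : C}
    (f : X ~> X') (g : Y ~> Y') :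
  f ⊠ g = (f ⊠ idm Y') ∘ (idm X ⊠ g).
Proof. by rewrite -tensm_comp ccompm1 ccomp1m. Qed.

Lemma tensm_split_rl {C : monoidal_category} {X X' Y Y' : C}
    (f : X ~> X') (g : Y ~> Y') :
  f ⊠ g = (idm X' ⊠ g) ∘ (f ⊠ idm Y).
Proof. by rewrite -tensm_comp ccompm1 ccomp1m. Qed.

Lemma tensm_compl {C : monoidal_category} {X Y Z : C} (W : C)
    (g : Y ~> Z) (f : X ~> Y) :
  (g ∘ f) ⊠ idm W = (g ⊠ idm W) ∘ (f ⊠ idm W).
Proof. by rewrite -tensm_comp ccompm1. Qed.

Lemma tensm_compr {C : monoidal_category} {X Y Z : C} (W : C)
    (g : Y ~> Z) (f : X ~> Y) :
  idm W ⊠ (g ∘ f) = (idm W ⊠ g) ∘ (idm W ⊠ f).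
Proof. by rewrite -tensm_comp ccompm1. Qed.

Lemma split_epi_cancel {C : category} {X Y Z : C} (e : X ~> Y) (s : Y ~> X)
    (f g : Y ~> Z) :
  e ∘ s = idm Y -> f ∘ e = g ∘ e -> f = g.
Proof.
by move=> es /(f_equal (fun h => h ∘ s)); rewrite -!ccompA es !ccompm1.
Qed.

Lemma split_mono_cancel {C : category} {X Y Z : C} (e : Y ~> Z) (s : Z ~> Y)
    (f g : X ~> Y) :
  s ∘ e = idm Y -> e ∘ f = e ∘ g -> f = g.
Proof.
by move=> se /(f_equal (fun h => s ∘ h)); rewrite !ccompA se !ccomp1m.
Qed.

Lemma tens_unit_faithful_l {C : monoidal_category} {X Y : C} (f g : X ~> Y) :
  idm unitob ⊠ f = idm unitob ⊠ g -> f = g.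
Proof.
move=> fg; apply: (split_epi_cancel (lunit X) (lunitV X)); first exact: lunitVK.
by rewrite -!lunit_nat fg.
Qed.

Lemma tens_unit_faithful_r {C : monoidal_category} {X Y : C} (f g : X ~> Y) :
  f ⊠ idm unitob = g ⊠ idm unitob -> f = g.
Proof.
move=> fg; apply: (split_epi_cancel (runit X) (runitV X)); first exact: runitVK.
by rewrite -!runit_nat fg.
Qed.

(** Kelly's argument: tensoring with the unit on the left is faithful, and
    after it both sides meet in the pentagon on S, S, X, Y, whose edges the
    triangle evaluates. *)
Lemma lunit_assoc {C : monoidal_category} (X Y : C) :
  lunit (X ⊗ Y) ∘ assoc unitob X Y = lunit X ⊠ idm Y.
Proof.
apply: tens_unit_faithful_l.
apply: (split_epi_cancel (assoc unitob (unitob ⊗ X) Y) (assocV _ _ _)).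
  exact: assocVK.
apply: (split_epi_cancel (assoc unitob unitob X ⊠ idm Y)
                         (assocV unitob unitob X ⊠ idm Y)).
  by rewrite -tensm_compl assocVK tensm1.
rewrite tensm_compr -!ccompA [Z in _ ∘ Z]ccompA -pentagon.
by rewrite ccompA triangle -tensm1 -assoc_nat ccompA -assoc_nat -ccompA
     -tensm_compl triangle.
Qed.

(** The mirror image of [lunit_assoc], from the pentagon on X, Y, S, S. *)
Lemma assoc_runit {C : monoidal_category} (X Y : C) :
  (idm X ⊠ runit Y) ∘ assoc X Y unitob = runit (X ⊗ Y).
Proof.
apply: tens_unit_faithful_r.
apply: (split_mono_cancel (assoc X Y unitob) (assocV _ _ _)).
  exact: assocK.
rewrite tensm_compl ccompA assoc_nat -triangle tensm_compr -!ccompA.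
rewrite [Z in _ ∘ Z]ccompA -pentagon.
by rewrite ccompA -assoc_nat tensm1 -ccompA triangle.
Qed.

(** * The bimodule and the map to the ring determined by an Ideal *)

Lemma ideal_jL_lunit {C : monoidal_category} {R : ring_object C} {I : C}
    (A : Ideal R I) :
  ideal_jL A ∘ lunit I = ideal_nuL A ∘ (rone R ⊠ idm I).
Proof. by rewrite /ideal_jL -!ccompA lunitK ccompm1. Qed.

Lemma ideal_jR_runit {C : monoidal_category} {R : ring_object C} {I : C}
    (A : Ideal R I) :
  ideal_jR A ∘ runit I = ideal_nuR A ∘ (idm I ⊠ rone R).
Proof. by rewrite /ideal_jR -!ccompA runitK ccompm1. Qed.

Lemma ideal_is_bimodule {C : monoidal_category} {R : ring_object C} {I : C}
    (A : Ideal R I) :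
  is_bimodule (ideal_muL A) (ideal_muR A).
Proof.
split.
- by have := ecomp1m A ob_b ob_a; rewrite ideal_ida.
- by have := ecompA A ob_b ob_a ob_a ob_a; rewrite ideal_aaa.
- by have := ecompm1 A ob_b ob_a; rewrite ideal_idb.
- by have := ecompA A ob_b ob_b ob_b ob_a; rewrite ideal_bbb.
- by have := ecompA A ob_b ob_b ob_a ob_a.
Qed.

Lemma ideal_nuL_lact {C : monoidal_category} {R : ring_object C} {I : C}
    (A : Ideal R I) :
  ideal_nuL A ∘ (rmul R ⊠ idm I) =
  rmul R ∘ (idm R ⊠ ideal_nuL A) ∘ assoc R R I.
Proof.
by have := ecompA A ob_b ob_a ob_b ob_b; rewrite ideal_abb ideal_bbb.
Qed.

Lemma ideal_nuL_ract {C : monoidal_category} {R : ring_object C} {I : C}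
    (A : Ideal R I) :
  rmul R ∘ (ideal_nuL A ⊠ idm R) =
  ideal_nuL A ∘ (idm R ⊠ ideal_muR A) ∘ assoc R I R.
Proof. by have := ecompA A ob_b ob_b ob_a ob_b; rewrite ideal_bbb. Qed.

Lemma ideal_nuR_lact {C : monoidal_category} {R : ring_object C} {I : C}
    (A : Ideal R I) :
  ideal_nuR A ∘ (ideal_muL A ⊠ idm R) =
  rmul R ∘ (idm R ⊠ ideal_nuR A) ∘ assoc R I R.
Proof. by have := ecompA A ob_a ob_b ob_a ob_a; rewrite ideal_aaa. Qed.

Lemma ideal_nuR_ract {C : monoidal_category} {R : ring_object C} {I : C}
    (A : Ideal R I) :
  rmul R ∘ (ideal_nuR A ⊠ idm R) =
  ideal_nuR A ∘ (idm I ⊠ rmul R) ∘ assoc I R R.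
Proof.
by have := ecompA A ob_a ob_a ob_b ob_a; rewrite ideal_aaa ideal_aab.
Qed.

Lemma ideal_nuL_bimodule_map {C : monoidal_category} {R : ring_object C}
    {I : C} (A : Ideal R I) :
  is_bimodule_map (RM_lact R I) (RM_ract (ideal_muR A)) (rmul R) (rmul R)
    (ideal_nuL A).
Proof.
split; last by rewrite /RM_ract ideal_nuL_ract ccompA.
by rewrite /RM_lact ccompA ideal_nuL_lact -ccompA assocVK ccompm1.
Qed.

Lemma ideal_nuR_bimodule_map {C : monoidal_category} {R : ring_object C}
    {I : C} (A : Ideal R I) :
  is_bimodule_map (MR_lact (ideal_muL A)) (MR_ract R I) (rmul R) (rmul R)
    (ideal_nuR A).
Proof.
split; last by rewrite /MR_ract ideal_nuR_ract ccompA.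
by rewrite /MR_lact ccompA ideal_nuR_lact -ccompA assocVK ccompm1.
Qed.

(** Associativity of u r m, for r an endomorphism of a. *)
Lemma ideal_nuL_jL_muL {C : monoidal_category} {R : ring_object C} {I : C}
    (A : Ideal R I) :
  ideal_nuL A = ideal_jL A ∘ ideal_muL A.
Proof.
have urm : ideal_nuL A ∘ (rmul R ⊠ idm I) =
    ideal_nuL A ∘ (idm R ⊠ ideal_muL A) ∘ assoc R R I.
  by have := ecompA A ob_b ob_a ob_a ob_b; rewrite ideal_aab.
apply: (split_epi_cancel (lunit (R ⊗ I)) (lunitV _)); first exact: lunitVK.
apply: (split_epi_cancel (assoc unitob R I) (assocV _ _ _)).
  exact: assocVK.
rewrite -(ccompA (ideal_jL A)) -(lunit_nat (ideal_muL A)) (ccompA (ideal_jL A)) ideal_jL_lunit.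
rewrite -!ccompA (ccompA (rone R ⊠ _)) -tensm_split_lr tensm_split_rl.
rewrite -!ccompA -tensm1 -assoc_nat lunit_assoc -rmul1m tensm_compl.
by rewrite (ccompA _ (rmul R ⊠ _)) urm !ccompA.
Qed.

(** Associativity of r u m, for r an endomorphism of b. *)
Lemma ideal_nuL_mul_jL {C : monoidal_category} {R : ring_object C} {I : C}
    (A : Ideal R I) :
  ideal_nuL A = rmul R ∘ (idm R ⊠ ideal_jL A).
Proof.
apply: (split_epi_cancel (idm R ⊠ lunit I) (idm R ⊠ lunitV I)).
  by rewrite -tensm_compr lunitVK tensm1.
apply: (split_epi_cancel (assoc R unitob I) (assocV _ _ _)).
  exact: assocVK.
rewrite -(ccompA (rmul R)) -tensm_compr ideal_jL_lunit tensm_compr -!ccompA.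
rewrite triangle -assoc_nat -rmulm1 tensm_compl.
by rewrite (ccompA _ (rmul R ⊠ _)) ideal_nuL_lact !ccompA.
Qed.

(** Associativity of m r u, for r an endomorphism of b. *)
Lemma ideal_nuR_jR_muR {C : monoidal_category} {R : ring_object C} {I : C}
    (A : Ideal R I) :
  ideal_nuR A = ideal_jR A ∘ ideal_muR A.
Proof.
have mru : ideal_nuR A ∘ (ideal_muR A ⊠ idm R) =
    ideal_nuR A ∘ (idm I ⊠ rmul R) ∘ assoc I R R.
  by have := ecompA A ob_a ob_b ob_b ob_a; rewrite ideal_abb.
apply: (split_epi_cancel (runit (I ⊗ R)) (runitV _)); first exact: runitVK.
rewrite -(ccompA (ideal_jR A)) -(runit_nat (ideal_muR A)) (ccompA (ideal_jR A)) ideal_jR_runit.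
rewrite -!ccompA -tensm_split_rl tensm_split_lr (ccompA _ (_ ⊠ idm R)) mru.
rewrite -assoc_runit -rmulm1 tensm_compr -!ccompA -tensm1.
by rewrite -assoc_nat.
Qed.

(** Associativity of m u r, for r an endomorphism of a. *)
Lemma ideal_nuR_jR_mul {C : monoidal_category} {R : ring_object C} {I : C}
    (A : Ideal R I) :
  ideal_nuR A = rmul R ∘ (ideal_jR A ⊠ idm R).
Proof.
apply: (split_epi_cancel (runit I ⊠ idm R) (runitV I ⊠ idm R)).
  by rewrite -tensm_compl runitVK tensm1.
rewrite -(ccompA (rmul R)) -tensm_compl ideal_jR_runit tensm_compl ccompA.
rewrite ideal_nuR_ract -!ccompA assoc_nat -triangle -rmul1m tensm_compr.
by rewrite -!ccompA.
Qed.

(** Associativity of u m u. *)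
Lemma ideal_jL_jR {C : monoidal_category} {R : ring_object C} {I : C}
    (A : Ideal R I) :
  ideal_jL A = ideal_jR A.
Proof.
have rms : rmul R ∘ (ideal_nuL A ⊠ idm R) =
    rmul R ∘ (idm R ⊠ ideal_nuR A) ∘ assoc R I R.
  by have := ecompA A ob_a ob_b ob_a ob_b; rewrite ideal_abb ideal_aab.
apply: (split_epi_cancel (lunit I) (lunitV I)); first exact: lunitVK.
apply: (split_epi_cancel (runit (unitob ⊗ I)) (runitV _)).
  exact: runitVK.
have umu_l : rmul R ∘ (ideal_nuL A ⊠ idm R) ∘ ((rone R ⊠ idm I) ⊠ rone R) =
    ideal_jL A ∘ lunit I ∘ runit (unitob ⊗ I).
  rewrite ideal_jL_lunit -runit_nat -rmulm1 -!ccompA -tensm_split_rl.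
  by rewrite -tensm_comp ccomp1m.
have umu_r : rmul R ∘ (idm R ⊠ ideal_nuR A) ∘ (rone R ⊠ (idm I ⊠ rone R)) =
    ideal_jR A ∘ runit I ∘ lunit (I ⊗ unitob).
  rewrite ideal_jR_runit -lunit_nat -rmul1m -!ccompA -tensm_split_lr.
  by rewrite -tensm_comp ccomp1m.
rewrite -umu_l rms -(ccompA _ (assoc R I R)) assoc_nat ccompA umu_r.
by rewrite -!ccompA lunit_assoc runit_nat.
Qed.

(** Associativity of m u m'. *)
Lemma ideal_balanced {C : monoidal_category} {R : ring_object C} {I : C}
    (A : Ideal R I) :
  ideal_muR A ∘ (idm I ⊠ ideal_jL A) = ideal_muL A ∘ (ideal_jL A ⊠ idm I).
Proof.
have mrm : ideal_muL A ∘ (ideal_nuR A ⊠ idm I) =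
    ideal_muR A ∘ (idm I ⊠ ideal_nuL A) ∘ assoc I R I.
  exact: (ecompA A ob_b ob_a ob_b ob_a).
apply: (split_epi_cancel (runit I ⊠ idm I) (runitV I ⊠ idm I)).
  by rewrite -tensm_compl runitVK tensm1.
rewrite {2}ideal_jL_jR -!ccompA -tensm_compl ideal_jR_runit tensm_compl.
rewrite (ccompA (ideal_muL A)) mrm -!ccompA assoc_nat -triangle.
by rewrite !(ccompA (idm I ⊠ _)) -!tensm_compr ideal_jL_lunit.
Qed.

(** * The Ideal determined by a bimodule map to the ring *)

Definition bimodule_comp {C : monoidal_category} {R : ring_object C} {I : C}
    (muL : R ⊗ I ~> I) (muR : I ⊗ R ~> I) (j : I ~> R) (x y z : ideal_ob) :
    ideal_hom R I y z ⊗ ideal_hom R I x y ~> ideal_hom R I x z :=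
  match x, y, z with
  | ob_b, ob_a, ob_a => muL
  | ob_b, ob_b, ob_a => muR
  | ob_b, ob_a, ob_b => j ∘ muL
  | ob_a, ob_b, ob_a => j ∘ muR
  | ob_a, ob_a, _ | _, ob_b, ob_b => rmul R
  end.

Definition to_ring {C : monoidal_category} {R : ring_object C} {I : C}
    (j : I ~> R) (x y : ideal_ob) : ideal_hom R I x y ~> R :=
  match x, y with
  | ob_b, ob_a => j
  | _, _ => idm R
  end.

Lemma to_ring_comp {C : monoidal_category} {R : ring_object C} {I : C}
    (muL : R ⊗ I ~> I) (muR : I ⊗ R ~> I) (j : I ~> R) (x y z : ideal_ob) :
  is_bimodule_map muL muR (rmul R) (rmul R) j ->
  to_ring j x z ∘ bimodule_comp muL muR j x y z =
  rmul R ∘ (to_ring j y z ⊠ to_ring j x y).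
Proof.
by case=> jl jr; case: x y z => [] [] [] /=;
  rewrite ?tensm1 ?ccompm1 ?ccomp1m.
Qed.

(** Both sides compute the product in R of the images of three factors. *)
Lemma to_ring_compA {C : monoidal_category} {R : ring_object C} {I : C}
    (muL : R ⊗ I ~> I) (muR : I ⊗ R ~> I) (j : I ~> R) (w x y z : ideal_ob) :
  is_bimodule_map muL muR (rmul R) (rmul R) j ->
  to_ring j w z ∘ (bimodule_comp muL muR j w x z ∘
    (bimodule_comp muL muR j x y z ⊠ idm (ideal_hom R I w x))) =
  to_ring j w z ∘ (bimodule_comp muL muR j w y z ∘
    (idm (ideal_hom R I y z) ⊠ bimodule_comp muL muR j w x y) ∘
    assoc (ideal_hom R I y z) (ideal_hom R I x y) (ideal_hom R I w x)).
Proof.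
move=> jmap; rewrite !ccompA !to_ring_comp //.
rewrite -!(ccompA (rmul R)) -!tensm_comp !to_ring_comp //.
rewrite !ccompm1 -[in LHS](ccomp1m (to_ring j w x)).
rewrite -[in RHS](ccomp1m (to_ring j y z)) !tensm_comp.
by rewrite -!ccompA -assoc_nat !ccompA rmulA.
Qed.

(** Elementwise: j (m r) m' = (m r) j m' by balance, and this is
    m (r j m') = m j (r m') because j is left linear. *)
Lemma act_along_balanced {C : monoidal_category} {R : ring_object C} {I : C}
    (muL : R ⊗ I ~> I) (muR : I ⊗ R ~> I) (j : I ~> R) :
  is_bimodule muL muR ->
  is_bimodule_map muL muR (rmul R) (rmul R) j ->
  muR ∘ (idm I ⊠ j) = muL ∘ (j ⊠ idm I) ->
  muL ∘ ((j ∘ muR) ⊠ idm I) = muR ∘ (idm I ⊠ (j ∘ muL)) ∘ assoc I R I.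
Proof.
move=> bim [jl _] bal.
rewrite tensm_compl ccompA -bal -ccompA -tensm_split_rl tensm_split_lr.
rewrite ccompA (ract_assoc bim) -!ccompA -tensm1 assoc_nat.
by rewrite (ccompA (idm I ⊠ _)) -tensm_compr jl.
Qed.

Lemma bimodule_compA {C : monoidal_category} {R : ring_object C} {I : C}
    (muL : R ⊗ I ~> I) (muR : I ⊗ R ~> I) (j : I ~> R) (w x y z : ideal_ob) :
  is_bimodule muL muR ->
  is_bimodule_map muL muR (rmul R) (rmul R) j ->
  muR ∘ (idm I ⊠ j) = muL ∘ (j ⊠ idm I) ->
  bimodule_comp muL muR j w x z ∘
    (bimodule_comp muL muR j x y z ⊠ idm (ideal_hom R I w x)) =
  bimodule_comp muL muR j w y z ∘
    (idm (ideal_hom R I y z) ⊠ bimodule_comp muL muR j w x y) ∘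
    assoc (ideal_hom R I y z) (ideal_hom R I x y) (ideal_hom R I w x).
Proof.
move=> bim jmap bal; have := to_ring_compA muL muR j w x y z jmap.
case: w z => [] [] /=; rewrite ?ccomp1m //= => _.
case: x y => [] [] /=.
- exact: lact_assoc bim.
- exact: act_along_balanced.
- exact: lract_assoc bim.
- exact: ract_assoc bim.
Qed.

Definition ideal_of_bimodule {C : monoidal_category} {R : ring_object C}
    {I : C} (muL : R ⊗ I ~> I) (muR : I ⊗ R ~> I) (j : I ~> R)
    (bim : is_bimodule muL muR)
    (jmap : is_bimodule_map muL muR (rmul R) (rmul R) j)
    (bal : muR ∘ (idm I ⊠ j) = muL ∘ (j ⊠ idm I)) : Ideal R I.
Proof.
(* The identity is rone R at both objects; the match lets each endomorphism
   object reduce to R. *)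
unshelve refine (@MkIdeal C R I (@Enriched C _ _ (bimodule_comp muL muR j)
  (fun x => match x with ob_a | ob_b => rone R end) _ _ _) _ _ _ _ _ _) => //.
- by move=> w x y z; apply: bimodule_compA.
- by case=> [] []; rewrite /= ?rmul1m ?(lact_unit bim).
- by case=> [] []; rewrite /= ?rmulm1 ?(ract_unit bim).
Defined.

Theorem lemma2 (C : closed_triangulated_category) (R : ring_object C) :
  (forall (I : C) (A : Ideal R I),
     let muL := ideal_muL A in
     let muR := ideal_muR A in
     let nuL := ideal_nuL A in
     let nuR := ideal_nuR A in
     let j := ideal_jL A in
     (is_bimodule muL muR) /\
     (is_bimodule_map (RM_lact R I) (RM_ract muR) (rmul R) (rmul R) nuL /\
      is_bimodule_map (MR_lact muL) (MR_ract R I) (rmul R) (rmul R) nuR) /\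
     (ideal_jL A = ideal_jR A) /\
     (is_bimodule_map muL muR (rmul R) (rmul R) j) /\
     (muR ∘ (idm I ⊠ j) = muL ∘ (j ⊠ idm I)) /\
     ((nuL = j ∘ muL /\ nuL = rmul R ∘ (idm R ⊠ j)) /\
      (nuR = j ∘ muR /\ nuR = rmul R ∘ (j ⊠ idm R))))
  /\
  (forall (I : C) (muL : R ⊗ I ~> I) (muR : I ⊗ R ~> I) (j : I ~> R),
     is_bimodule muL muR ->
     is_bimodule_map muL muR (rmul R) (rmul R) j ->
     muR ∘ (idm I ⊠ j) = muL ∘ (j ⊠ idm I) ->
     exists A : Ideal R I,
       [/\ ideal_muL A = muL, ideal_muR A = muR,
           ideal_nuL A = j ∘ muL & ideal_nuR A = j ∘ muR]).
Proof.
split=> [I A /= | I muL muR j bim jmap bal]; last first.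
  by exists (ideal_of_bimodule muL muR j bim jmap bal).
split; first exact: ideal_is_bimodule.
split; first by split;
  [exact: ideal_nuL_bimodule_map | exact: ideal_nuR_bimodule_map].
split; first exact: ideal_jL_jR.
have nuL_jmu := ideal_nuL_jL_muL A; have nuL_muj := ideal_nuL_mul_jL A.
have nuR_jmu := ideal_nuR_jR_muR A; have nuR_muj := ideal_nuR_jR_mul A.
rewrite -ideal_jL_jR in nuR_jmu nuR_muj.
split; first by split; [rewrite -nuL_jmu | rewrite -nuR_jmu].
by split; first exact: ideal_balanced.
Qed.
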